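(* Let $K$ be a simplicial complex on $[m]$. The spaces $C_K(I)$, $I=(i_1,\dots,i_m)\in\mathbb{N}^m$, have the following descriptions. (1) $C_K(1,\dots,1)$ is homeomorphic to the complement $D_K$ of the diagonal arrangement associated with $K$. (2) For $I\prec(1,\dots,1)$, $C_K(I)$ is homeomorphic to the complement $D_L$ of the diagonal arrangement associated with the full subcomplex $L=K|_{\operatorname{supp}(I)}$, where $\operatorname{supp}(I)=\{j: i_j\neq 0\}$. (3) For $I\not\preceq(1,\dots,1)$, $C_K(I)$ is homeomorphic to a union of certain connected components of $D_{K'}$, where $K'=K(V[i_1],\dots,V[i_m])$; more precisely, of those defined by the inequalities $t_j(1)<t_j(2)<\dots<t_j(i_j)$ for $j\in[m]$, where $t_j(1),\dots,t_j(i_j)$ are the coordinates indexed by the vertices of $V[i_j]$.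
   Context: $[m]=\{1,\dots,m\}$; $\mathbb{N}$ denotes the non-negative integers; $I\prec J$ means $i_k\le j_k$ for all $k$ and $I\ne J$; $I\preceq J$ means $I\prec J$ or $I=J$. A simplicial complex on a finite set is a collection of subsets containing $\emptyset$ and closed under taking subsets; $K|_V=\{\sigma\in K:\sigma\subset V\}$. A missing face of $K$ is a subset $\tau$ of the vertex set with $\tau\notin K$ all of whose proper subsets are in $K$. For a simplicial complex $L$ on a finite set $S$, $D_L\subset\mathbb{R}^S$ is the complement of the union of the diagonal subspaces $\{x_{j_1}=\dots=x_{j_r}\}$, one for each missing face $\{j_1,\dots,j_r\}$ of $L$. Let $B(k)$ be the space of $k$-element subsets $\{t(1)<\dots<t(k)\}$ of $\mathbb{R}$. $C_K(I)\subset B(i_1)\times\dots\times B(i_m)$ consists of all $(\mathbf{t}_1,\dots,\mathbf{t}_m)$ with $\bigcap_{j\in\tau}\mathbf{t}_j=\emptyset$ for each $\tau\notin K$. $V[n]$ is the simplicial complex consisting of $n$ disjoint vertices $1,\dots,n$. For simplicial complexes $L_1,\dots,L_m$ on sets $V_1,\dots,V_m$, $K(L_1,\dots,L_m)$ is the simplicial complex on $V_1\sqcup\dots\sqcup V_m$ in which $\bigsqcup_{i\in\sigma}S_i$ (with $\sigma\subset[m]$ and $S_i\subset V_i$ non-empty for $i\in\sigma$) is a simplex if and only if $\sigma\in K$ and $S_i\in L_i$ for every $i\in\sigma$. *)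

(* Defs.v *)
From HB Require Import structures.
From mathcomp Require Import all_boot all_order all_algebra.
From mathcomp Require Import generic_quotient.
From mathcomp Require Import all_classical all_reals all_analysis.

Set Implicit Arguments.
Unset Strict Implicit.
Unset Printing Implicit Defensive.

Import Order.TTheory GRing.Theory Num.Theory.
Import numFieldNormedType.Exports.
Local Open Scope classical_set_scope.
Local Open Scope card_scope.
Local Open Scope ring_scope.

(* Singletons are not required to be faces, so a missing face may be a
   singleton. *)
Record complex (S : finType) := Complex {
  faces :> {set {set S}};
  complex_set0 : finset.set0 \in faces;
  complex_subset : forall s t : {set S}, s \subset t -> t \in faces ->
    s \in faces }.

Definition missing_face (S : finType) (L : complex S) (t : {set S}) : Prop :=
  t \notin L /\ forall s : {set S}, s \proper t -> s \in L.

Section FullSubcomplex.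
Variables (S : finType) (K : complex S) (V : {set S}).

(* K|_V as a complex on the finite set V, i.e. on the subtype of S that V
   defines. *)
Definition full_subcomplex_faces : {set {set {x : S | x \in V}}} :=
  [set s : {set {x : S | x \in V}} | val @: s \in K]%SET.

Lemma full_subcomplex_set0 : finset.set0 \in full_subcomplex_faces.
Proof. by rewrite inE imset0 complex_set0. Qed.

Lemma full_subcomplex_subset (s t : {set {x : S | x \in V}}) :
  s \subset t -> t \in full_subcomplex_faces -> s \in full_subcomplex_faces.
Proof. by rewrite !inE => st; apply: complex_subset; exact: imsetS. Qed.

Definition full_subcomplex : complex {x : S | x \in V} :=
  Complex full_subcomplex_set0 full_subcomplex_subset.

End FullSubcomplex.

Section DisjointVertices.
Variable n : nat.

Definition vertices_faces : {set {set 'I_n}} :=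
  [set s : {set 'I_n} | (#|s| <= 1)%N]%SET.

Lemma vertices_set0 : finset.set0 \in vertices_faces.
Proof. by rewrite inE cards0. Qed.

Lemma vertices_subset (s t : {set 'I_n}) :
  s \subset t -> t \in vertices_faces -> s \in vertices_faces.
Proof. by rewrite !inE => /subset_leq_card; exact: leq_trans. Qed.

(* V[n] *)
Definition vertices : complex 'I_n := Complex vertices_set0 vertices_subset.

End DisjointVertices.

Section Substitution.
Variables (J : finType) (V : J -> finType).
Variables (K : complex J) (L : forall j, complex (V j)).

Definition dunion (s : {set J}) (A : forall j, {set V j}) :
    {set {j : J & V j}} :=
  [set x : {j : J & V j} | (tag x \in s) && (tagged x \in A (tag x))]%SET.

Definition tags (t : {set {j : J & V j}}) : {set J} := [set tag x | x in t]%SET.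

Definition slice (t : {set {j : J & V j}}) (j : J) : {set V j} :=
  [set v : V j | Tagged (fun j => V j) v \in t]%SET.

(* Every t is uniquely the disjoint union, over j in [tags t], of the nonempty
   sets [slice t j]; see [substitutionP]. *)
Definition substitution_faces : {set {set {j : J & V j}}} :=
  [set t : {set {j : J & V j}} |
    (tags t \in K) && [forall j in tags t, slice t j \in L j]]%SET.

Lemma substitution_set0 : finset.set0 \in substitution_faces.
Proof.
rewrite inE /tags imset0 complex_set0 /=.
by apply/forall_inP => j; rewrite inE.
Qed.

Lemma substitution_subset (s t : {set {j : J & V j}}) :
  s \subset t -> t \in substitution_faces -> s \in substitution_faces.
Proof.
move=> st; rewrite !inE => /andP[tK /forall_inP tL]; apply/andP; split.
  by apply: complex_subset tK; exact: imsetS.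
apply/forall_inP => j js.
apply: (complex_subset (t := slice t j)).
  by apply/fintype.subsetP => v; rewrite !inE; exact: (fintype.subsetP st).
by apply: tL; apply: (fintype.subsetP (imsetS _ st)).
Qed.

(* K(L_1, ..., L_m) *)
Definition substitution : complex {j : J & V j} :=
  Complex substitution_set0 substitution_subset.

Lemma substitutionP (s : {set J}) (A : forall j, {set V j}) :
  (forall j, j \in s -> A j != finset.set0) ->
  (dunion s A \in substitution) <->
  (s \in K /\ forall j, j \in s -> A j \in L j).
Proof.
move=> A0.
have tagsE : tags (dunion s A) = s.
  apply/setP => j; apply/imsetP/idP => [[x + ->]|js]; first by rewrite inE => /andP[].
  have /set0Pn[v vA] := A0 _ js.
  by exists (Tagged (fun j => V j) v) => //; rewrite inE /= js.
have sliceE j : j \in s -> slice (dunion s A) j = A j.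
  by move=> js; apply/setP => v; rewrite !inE /= js.
rewrite inE tagsE; split=> [/andP[sK /forall_inP sL]|[sK sL]].
  by split=> // j js; rewrite -sliceE //; exact: sL.
by rewrite sK; apply/forall_inP => j js; rewrite sliceE //; exact: sL.
Qed.

End Substitution.

Section DiagonalArrangement.
Variables (R : realType) (S : finType).

Definition diagonal_subspace (t : {set S}) : set {ptws S -> R} :=
  [set x | forall i j, i \in t -> j \in t -> x i = x j].

Definition diagonal_complement (L : complex S) : set {ptws S -> R} :=
  ~` \bigcup_(t in [set t | missing_face L t]) diagonal_subspace t.

End DiagonalArrangement.

Arguments diagonal_complement R {S} L _.

Lemma card_setT_ord (k : nat) : [set: 'I_k] #= `I_k.
Proof.
have : range (@nat_of_ord k) #= [set: 'I_k].
  exact: (inj_card_eq (in2W (@ord_inj k))).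
rewrite card_eq_sym => /card_eq_trans; apply.
rewrite (_ : range _ = `I_k) //; apply/seteqP; split=> [_ [i _ <-]//=|i /= ik].
by exists (Ordinal ik).
Qed.

Section UnorderedConfigurations.
Variables (R : realType) (k : nat).

Definition ordered_config : set {ptws 'I_k -> R} :=
  [set x | injective (x : 'I_k -> R)].

Definition ksubset := {t : set R | t #= `I_k}.

Lemma range_ordered_config (x : ordered_config) :
  range (val x : 'I_k -> R) #= `I_k.
Proof.
have xinj : injective (val x : 'I_k -> R) by have := set_valP x.
apply: (card_eq_trans (inj_card_eq (in2W xinj))).
exact: card_setT_ord.
Qed.

Definition forget_order (x : ordered_config) : ksubset :=
  exist _ (range (val x : 'I_k -> R)) (range_ordered_config x).

Lemma forget_order_surj (t : ksubset) : exists x, forget_order x = t.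
Proof.
case: t => t tk.
have : t #= [set: 'I_k].
  by apply: card_eq_trans tk _; rewrite card_eq_sym; exact: card_setT_ord.
rewrite card_eq_sym => /(@pcard_eqP 'I_k R)/bijPex[f [ft finj fsurj]].
have xinj : injective (f : 'I_k -> R).
  by move=> i j; apply: finj; rewrite inE.
exists (exist _ (f : {ptws 'I_k -> R}) (mem_set xinj)).
apply: eq_sig_hprop => /=; first by move=> ? ? ?; exact: bool_irrelevance.
apply/seteqP; split=> [_ [i _ <-]|r /fsurj//].
exact: ft.
Qed.

(* The sets with k elements are the quotient of the ordered configurations by
   the permutations of the k points. *)
Definition enumeration (t : ksubset) : ordered_config :=
  projT1 (cid (forget_order_surj t)).

Lemma enumerationK : cancel enumeration forget_order.
Proof. by move=> t; exact: projT2 (cid (forget_order_surj t)). Qed.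

HB.instance Definition _ := isQuotient.Build ordered_config ksubset enumerationK.

(* B(k), with the quotient topology *)
Definition config := quotient_topology ksubset.

HB.instance Definition _ := Topological.on config.

Lemma pi_configE (x : ordered_config) :
  \pi_config%qT x = forget_order x :> ksubset.
Proof. by rewrite unlock. Qed.

Lemma config_openE (U : set config) : open U = open (forget_order @^-1` U).
Proof.
by rewrite {1}/open /= /quotient_open; congr open; apply/funext => x;
  rewrite /preimage /= pi_configE.
Qed.

Definition points (t : config) : set R := sval (t : ksubset).

End UnorderedConfigurations.

Section PolyhedralConfigurations.
Variables (R : realType) (m : nat) (K : complex 'I_m).
Implicit Types I : 'I_m -> nat.

(* C_K(I) *)
Definition polyconfig I : set (prod_topology (fun j => config R (I j))) :=
  [set t | forall s : {set 'I_m}, s \notin K ->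
    \bigcap_(j in [set j | j \in s]) points (t j) = set0].

Definition supp I : {set 'I_m} := [set j | I j != 0%N]%SET.

Definition precI I I' : Prop := (forall j, (I j <= I' j)%N) /\ I <> I'.

Definition preceqI I I' : Prop := precI I I' \/ I = I'.

(* K(V[i_1], ..., V[i_m]) *)
Definition blowup I : complex {j : 'I_m & 'I_(I j)} :=
  substitution K (fun j => vertices (I j)).

Definition increasing I : set {ptws {j : 'I_m & 'I_(I j)} -> R} :=
  [set x | forall (j : 'I_m) (a b : 'I_(I j)), (a < b)%N ->
    x (Tagged (fun j => 'I_(I j)) a) < x (Tagged (fun j => 'I_(I j)) b)].

End PolyhedralConfigurations.

Arguments polyconfig R {m} K I _.
Arguments increasing R {m} I _.
Arguments blowup {m} K I.

Definition homeomorphic (X Y : topologicalType) (A : set X) (B : set Y) : Prop :=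
  exists (f : A -> B) (g : B -> A),
    [/\ continuous f, continuous g, cancel f g & cancel g f].

Definition union_of_components (X : topologicalType) (D U : set X) : Prop :=
  exists2 P : set X, P `<=` D & U = \bigcup_(x in P) connected_component D x.

(* Main.v *)
(* A k-element subset of the reals is the same thing as its increasing
   enumeration, so B(k) is the cone x(1) < ... < x(k) and C_K(I) is a space of
   coordinate vectors.  A common point of the configurations t_j, j in s, for
   s not in K, is a choice of one coordinate in each block j of s with equal
   values: these are the diagonals of K(V[i_1], ..., V[i_m]) that meet the cone.
   The other diagonals identify two coordinates of one block, so their
   differences have constant sign on components of the complement. *)
Require Import Defs.
From mathcomp Require Import all_boot all_order all_algebra.
From mathcomp Require Import all_classical all_reals all_analysis.
Import Order.TTheory GRing.Theory Num.Theory numFieldNormedType.Exports.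
Local Open Scope classical_set_scope.

Set Implicit Arguments.
Unset Strict Implicit.
Unset Printing Implicit Defensive.

(** * Continuity for pointwise, product and subspace topologies *)

Lemma ptws_eval_continuous (R : realType) (S : eqType) (i : S) :
  continuous (fun x : {ptws S -> R} => x i).
Proof. exact: (@proj_continuous S (fun=> R) i). Qed.

Lemma continuous_prod_topology (I : Type) (T : I -> topologicalType)
    (X : topologicalType) (f : X -> prod_topology T) :
  (forall i, continuous (fun x => f x i)) -> continuous f.
Proof.
move=> cf x; apply/cvg_sup => i.
exact: (@continuous_comp_initial _ _ _ (fun g : forall i, T i => g i) f (cf i)).
Qed.

Lemma continuous_set_type (X Y : topologicalType) (A : set X) (f : Y -> A) :
  continuous (set_val \o f) -> continuous f.
Proof. exact: continuous_comp_initial. Qed.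

Lemma set_val_continuous (X : topologicalType) (A : set X) :
  continuous (set_val : A -> X).
Proof. exact: initial_continuous. Qed.

(** * Increasing enumerations of finite sets of reals *)

Section IncreasingEnumeration.
Variables (R : realType) (k : nat).
Implicit Types (x y : 'I_k -> R) (t : config R k).

Definition increasing_coords x := forall a b : 'I_k, (a < b)%N -> (x a < x b)%R.

Lemma increasing_coords_inj x : increasing_coords x -> injective x.
Proof.
move=> incx a b xab; apply: val_inj => /=; apply/eqP.
by case: ltngtP => // /incx; rewrite xab ltxx.
Qed.

Lemma increasing_coords_codom x : increasing_coords x -> sorted <%R (codom x).
Proof.
move=> incx; rewrite codomE sorted_map.
apply: (@sub_sorted _ (relpre val ltn)); first by move=> a b /incx.
by rewrite -sorted_map val_enum_ord iota_ltn_sorted.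
Qed.

(** Strictly sorted lists with the same members are equal, and [codom] lists the values in index
    order. *)
Lemma increasing_coords_range x y : increasing_coords x ->
  increasing_coords y -> range x = range y -> x = y.
Proof.
move=> incx incy xy; apply/funext => a.
have /eq_in_map : codom x = codom y.
  apply: lt_sorted_eq; [exact: increasing_coords_codom..|] => r.
  have mem z : (r \in codom z) <-> range z r.
    split=> [/codomP[b ->]|[b _ <-]]; [by exists b | exact: codom_f].
  by apply/idP/idP => /mem h; apply/mem; [rewrite -xy | rewrite xy].
by apply; rewrite mem_enum.
Qed.

Lemma increasing_reordering x : injective x ->
  exists2 s : 'I_k -> 'I_k, bijective s & increasing_coords (x \o s).
Proof.
move=> xinj.
pose e := sort (relpre x <=%R) (enum 'I_k).
have sz : size e = k by rewrite size_sort size_enum_ord.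
have srt : sorted <%R (map x e).
  by rewrite /e -sort_map sort_lt_sorted map_inj_uniq// enum_uniq.
(* ['I_k] may be empty, so each index [a] serves as its own default for [nth]; the default is never
   reached, since [e] has size [k]. *)
have incs : increasing_coords (x \o (fun a => nth a e a)).
  move=> a b ab /=; rewrite (set_nth_default b) ?sz//.
  by rewrite -!(nth_map b (x b)) ?sz// lt_sorted_ltn_nth// inE size_map sz.
exists (fun a => nth a e a) => //; apply: injF_bij.
by move=> a b sab; apply: (increasing_coords_inj incs); rewrite /= sab.
Qed.

Lemma increasing_enumeration t :
  exists2 x, increasing_coords x & range x = points t.
Proof.
have [y <-] := forget_order_surj t.
have yinj : injective (val y : 'I_k -> R) by have := set_valP y.
have [s [s' sK s'K] incs] := increasing_reordering yinj.
exists (val y \o s) => //; apply/seteqP; split=> _ [a _ <-].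
  by exists (s a).
by exists (s' a); rewrite //= s'K.
Qed.

(** A choice of enumeration, which [increasing_coords_range] shows to be unique; [coordsE] computes
    it. *)
Definition coords t : {ptws 'I_k -> R} :=
  projT1 (cid2 (increasing_enumeration t)).

Lemma coords_increasing t : increasing_coords (coords t).
Proof. by rewrite /coords; case: cid2. Qed.

Lemma range_coords t : range (coords t) = points t.
Proof. by rewrite /coords; case: cid2. Qed.

Lemma coordsE t x : increasing_coords x -> range x = points t -> coords t = x.
Proof.
move=> incx xt; apply: increasing_coords_range => //.
  exact: coords_increasing.
by rewrite range_coords xt.
Qed.

Lemma points_inj : injective (@points R k).
Proof.
move=> t u; rewrite /points => tu.
by apply: eq_sig_hprop => // ? ? ?; exact: bool_irrelevance.
Qed.

(** Universal property of the quotient topology on [config]. *)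
Lemma config_continuous (Z : topologicalType) (f : config R k -> Z) :
  continuous (f \o @forget_order R k : @ordered_config R k -> Z) ->
  continuous f.
Proof.
move=> /continuousP cf; apply/continuousP => A oA.
by rewrite config_openE; exact: cf.
Qed.

Lemma forget_order_continuous :
  continuous (@forget_order R k : @ordered_config R k -> config R k).
Proof. by apply/continuousP => A; rewrite config_openE. Qed.

(* The permutation sorting an ordered configuration also sorts the nearby
   ones. *)
Lemma coords_continuous : continuous coords.
Proof.
apply: continuous_prod_topology => a; apply: config_continuous => y0.
have yinj : injective (val y0 : 'I_k -> R) by have := set_valP y0.
have [s [s' sK s'K] incs] := increasing_reordering yinj.
have evalc b :
    continuous (fun y : @ordered_config R k => (val y : 'I_k -> R) b).
  move=> y; apply: (@continuous_comp _ _ _ set_val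
    (fun x : {ptws _ -> _} => x b)).
    exact: set_val_continuous.
  exact: ptws_eval_continuous.
pose lt_at (b c : 'I_k) (y : @ordered_config R k) :=
  (b < c)%N -> ((val y : 'I_k -> R) (s b) < (val y : 'I_k -> R) (s c))%R.
have near_incs : \forall y \near y0, forall b c, lt_at b c y.
  apply: (@filter_forall _ _ _ (nbhs y0)) => b.
  apply: (@filter_forall _ _ _ (nbhs y0)) => c.
  have [bc|nbc] := boolP (b < c)%N; last first.
    by apply: nearW => y; rewrite /lt_at (negbTE nbc).
  have cbc : continuous (fun y : @ordered_config R k =>
      (val y : 'I_k -> R) (s c) - (val y : 'I_k -> R) (s b) : R)%R.
    by move=> y; apply: (cvgB (evalc (s c) y) (evalc (s b) y)).
  have : (0 < (val y0 : 'I_k -> R) (s c) - (val y0 : 'I_k -> R) (s b))%R.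
    by rewrite subr_gt0; exact: incs.
  move=> /(cvgr_gt _ (cbc y0)); apply: filterS => y.
  by rewrite /lt_at subr_gt0.
have coordsy (y : @ordered_config R k) :
    increasing_coords ((val y : 'I_k -> R) \o s) ->
    coords (forget_order y) = (val y : 'I_k -> R) \o s.
  move=> incy; apply: coordsE => //; apply/seteqP; split=> _ [b _ <-].
    by exists (s b).
  by exists (s' b); rewrite //= s'K.
(* Near [y0], entry [a] of [coords] is evaluation at the fixed index [s a]. *)
rewrite /continuous_at /= coordsy//=.
apply: cvg_trans (evalc (s a) y0); apply: (@near_eq_cvg _ _ (nbhs y0)).
by apply: filterS near_incs => y incy; rewrite /= coordsy.
Qed.

End IncreasingEnumeration.

(** * Configuration spaces and diagonal complements as spaces of coordinate vectors *)

Section Coordinates.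
Variables (R : realType) (m : nat) (K : complex 'I_m) (I : 'I_m -> nat).

Local Notation index := {j : 'I_m & 'I_(I j)}.
Local Notation at_ j a := (Tagged (fun j => 'I_(I j)) (i := j) a).

(** The condition defining [polyconfig], on coordinate vectors: [c] is a common point of the
    configurations indexed by [s]. *)
Definition collision_free (x : index -> R) := forall s : {set 'I_m},
  s \notin K -> ~ exists c, forall j, j \in s -> exists a, x (at_ j a) = c.

Lemma collision_freeP (t : prod_topology (fun j => config R (I j)))
    (x : index -> R) :
  (forall j, range (fun a => x (at_ j a)) = points (t j)) ->
  polyconfig R K I t <-> collision_free x.
Proof.
move=> xt; split=> [tK s /tK st [c cs]|xK s /xK xs].
  suff : set0 c by [].
  by rewrite -st => j /= /cs [a ac]; rewrite -xt; exists a.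
rewrite -subset0 => c cs; apply: xs; exists c => j /cs.
by rewrite -xt => -[a _ ac]; exists a.
Qed.

(* [e] only renames the coordinates, so that the same map serves for vectors
   indexed by [m], by the support of I and by the blocks. *)
Lemma polyconfig_homeomorphic (S : finType) (e : index -> S) (e' : S -> index)
    (B : set {ptws S -> R}) : cancel e e' -> cancel e' e ->
  (forall x : {ptws S -> R},
     B x <-> increasing R I (x \o e) /\ collision_free (x \o e)) ->
  homeomorphic (polyconfig R K I) B.
Proof.
move=> eK e'K BP.
pose T := prod_topology (fun j => config R (I j)).
pose F (t : T) : {ptws S -> R} :=
  fun i => coords (t (tag (e' i))) (tagged (e' i)).
have Fe t j a : F t (e (at_ j a)) = coords (t j) a by rewrite /F eK.
have FB (t : polyconfig R K I) : F (val t) \in B.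
  rewrite inE; apply/BP; split=> [j a b ab|].
    by rewrite /= !Fe; exact: coords_increasing.
  apply/(collision_freeP (t := val t)); last exact: set_valP.
  move=> j; rewrite -range_coords; apply: (congr1 (fun z => range z)).
  by apply/funext => a; exact: Fe.
have Bincr (x : B) j :
    increasing_coords (fun a => (val x : S -> R) (e (at_ j a))).
  by move=> a b; have /BP[+ _] := set_valP x; exact.
pose sorted_at (x : B) j : @ordered_config R (I j) :=
  exist _ (fun a => (val x : S -> R) (e (at_ j a)))
    (mem_set (increasing_coords_inj (@Bincr x j))).
pose G (x : B) : T := fun j => forget_order (sorted_at x j).
have pointsG x j :
    points (G x j) = range (fun a => (val x : S -> R) (e (at_ j a))).
  by [].
have GK x : G x \in polyconfig R K I.
  rewrite inE; apply/(@collision_freeP _ ((val x : S -> R) \o e)) => //.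
  by have /BP[] := set_valP x.
exists (fun t => exist _ (F (val t)) (FB t)), (fun x => exist _ (G x) (GK x)).
split.
- apply: continuous_set_type; apply: continuous_prod_topology => i t.
  apply: (@continuous_comp _ _ _
    (fun t : polyconfig R K I => (val t : T) (tag (e' i)))
    (fun u => coords u (tagged (e' i)))).
    apply: (@continuous_comp _ _ _ set_val (fun t : T => t (tag (e' i)))).
      exact: set_val_continuous.
    exact: (@proj_continuous _ (fun j => config R (I j)) (tag (e' i))).
  apply: (@continuous_comp _ _ _ (@coords R _) (fun x => x (tagged (e' i)))).
    exact: coords_continuous.
  exact: ptws_eval_continuous.
- apply: continuous_set_type; apply: continuous_prod_topology => j x.
  have sorted_cont : continuous (sorted_at^~ j).
    apply: continuous_set_type; apply: continuous_prod_topology => a {}x.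
    apply: (@continuous_comp _ _ _ set_val
      (fun x : {ptws S -> R} => x (e (at_ j a)))).
      exact: set_val_continuous.
    exact: ptws_eval_continuous.
  exact: (continuous_comp (sorted_cont x) (@forget_order_continuous R (I j) _)).
(* A configuration is determined by its points, and [coords] preserves them. *)
- move=> t; apply: val_inj => /=; apply: functional_extensionality_dep => j.
  apply: points_inj; rewrite pointsG /= -range_coords.
  by apply: (congr1 (fun z => range z)); apply/funext => a /=; rewrite Fe.
(* Each block of [x] is increasing, hence is already the increasing enumeration of its range. *)
- move=> x; apply: val_inj => /=; apply/funext => i.
  rewrite -[in RHS](e'K i) /F.
  case: (e' i) => j a /=.
  by rewrite (@coordsE _ _ (G (x) j) (fun a => (val x : S -> R) (e (at_ j a)))).
Qed.

End Coordinates.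

(** Every nonface contains a missing face, and a larger index set has a smaller diagonal
    subspace. *)
Lemma diagonal_complementP (R : realType) (S : finType) (L : complex S)
    (x : {ptws S -> R}) : diagonal_complement R L x <->
  forall t : {set S}, t \notin L -> ~ diagonal_subspace t x.
Proof.
split=> [xL t tL xt|xL [t [tL _]]]; last exact: xL.
have [s /minsetP[sL smin] st] := minset_exists (P := fun s => s \notin L) tL.
apply: xL; exists s.
  split=> // r rs; apply: contraT => rL.
  by have := rs; rewrite properE (smin _ rL (proper_sub rs)) subxx.
by move=> i j /(fintype.subsetP st) it /(fintype.subsetP st); exact: xt.
Qed.

(** Common form of the first two claims: blocks have at most one coordinate, so the order condition
    is vacuous, and [f] identifies [S] with the nonempty blocks. *)
Lemma polyconfig_le1 (R : realType) (m : nat) (K : complex 'I_m)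
    (I : 'I_m -> nat) (S : finType) (f : S -> 'I_m) (L : complex S) :
  (forall j, (I j <= 1)%N) -> injective f ->
  (forall j, I j != 0%N -> exists i, f i = j) -> (forall i, I (f i) != 0%N) ->
  (forall s : {set S}, (s \in L) = ((f @: s)%SET \in K)) ->
  homeomorphic (polyconfig R K I) (diagonal_complement R L).
Proof.
move=> I1 finj fsurj fI LK.
have pos i : (0 < I (f i))%N by rewrite lt0n.
have I0 j : 'I_(I j) -> I j != 0%N by case=> a; case: (I j).
pose e (p : {j : 'I_m & 'I_(I j)}) : S :=
  projT1 (cid (fsurj _ (I0 _ (tagged p)))).
have fe p : f (e p) = tag p by rewrite /e; case: cid.
pose e' i : {j : 'I_m & 'I_(I j)} :=
  Tagged (fun j => 'I_(I j)) (Ordinal (pos i)).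
have ord_eq j (a b : 'I_(I j)) : a = b.
  have ord0 (c : 'I_(I j)) : c = 0%N :> nat.
    by apply/eqP; rewrite -leqn0 -ltnS (leq_trans (ltn_ord c)).
  by apply: val_inj; rewrite /= !ord0.
have e'K : cancel e' e by move=> i; apply: finj; rewrite fe.
have eK : cancel e e'.
  move=> [j a]; rewrite /e'; have /= := fe (Tagged (fun j => 'I_(I j)) a).
  (* The bound of the ordinal in [e'] depends on [f i], so the value of [e] and the proof [pos i]
     are generalized before [f i] is replaced. *)
  move: (e _) => i; move: (pos i) => + ij; rewrite ij => p.
  by congr existT; exact: ord_eq.
apply: (polyconfig_homeomorphic eK e'K) => x.
rewrite diagonal_complementP; split=> [xL|[_ xK] t tL xt].
  split=> [j a b|s sK [c cs]]; first by rewrite (ord_eq _ a b) ltnn.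
  (* [cs] yields a coordinate in each block of [s], so [s] avoids the empty blocks, which [f]
     misses. *)
  have fs : (f @: (f @^-1: s) = s)%SET.
    apply/setP => j; apply/imsetP/idP => [[i + ->]|js]; first by rewrite inE.
    have [a _] := cs _ js; have [i fij] := fsurj _ (I0 _ a).
    by exists i; rewrite ?inE fij.
  apply: (xL (f @^-1: s)%SET); first by rewrite LK fs.
  suff xc i : i \in (f @^-1: s)%SET -> x i = c by move=> i j /xc-> /xc->.
  by rewrite inE => /cs[a <-] /=; congr x; apply: finj; rewrite fe.
have : t != finset.set0 by apply: contraNneq tL => ->; exact: complex_set0.
case/set0Pn => i0 i0t.
apply: (xK (f @: t)%SET); first by rewrite -LK.
exists (x i0) => _ /imsetP[i it ->]; exists (Ordinal (pos i)).
by rewrite /= -/(e' i) e'K; exact: xt.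
Qed.

(** * The blown-up complex and the increasing cone *)

Section Blowup.
Variables (R : realType) (m : nat) (K : complex 'I_m) (I : 'I_m -> nat).

Local Notation at_ j a := (Tagged (fun j => 'I_(I j)) (i := j) a).

(** Faces of [vertices] have at most one element, so two vertices of one block form a nonface of
    [blowup]. *)
Lemma diagonal_complement_blowup_neq (x : {ptws _ -> R}) j (a b : 'I_(I j)) :
  diagonal_complement R (blowup K I) x -> a != b -> x (at_ j a) != x (at_ j b).
Proof.
move=> /diagonal_complementP xD ab; apply/eqP => xab.
apply: (xD [set at_ j a; at_ j b]%SET).
  rewrite inE negb_and; apply/orP; right; apply/forall_inP => /(_ j).
  have -> : j \in tags [set at_ j a; at_ j b]%SET.
    by apply/imsetP; exists (at_ j a); rewrite // !inE eqxx.
  move=> /(_ isT); rewrite inE leqNgt => /negP; apply.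
  apply/card_gt1P; exists a, b; rewrite !inE !eqxx ?orbT//.
by move=> p q; rewrite !inE => /orP[]/eqP-> /orP[]/eqP->.
Qed.

(** A nonface of [blowup] has [tags] outside [K] or contains two vertices of one block; diagonals of
    the latter kind miss [increasing]. *)
Lemma blowup_increasingP (x : {ptws _ -> R}) :
  (diagonal_complement R (blowup K I) `&` increasing R I) x <->
  increasing R I x /\ collision_free K x.
Proof.
split=> [[/diagonal_complementP xD xI]|[xI xK]]; split=> //.
  move=> s sK [c cs].
  (* By [cs] every block of [s] has a coordinate equal to [c], so [tags t = s]. *)
  pose t : {set {j : 'I_m & 'I_(I j)}} :=
    [set p | (tag p \in s) && (x p == c)]%SET.
  apply: (xD t); last first.
    by move=> p q; rewrite !inE => /andP[_ /eqP->] /andP[_ /eqP->].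
  suff ts : tags t = s by rewrite inE ts (negbTE sK).
  apply/setP => j; apply/imsetP/idP => [[p + ->]|js].
    by rewrite inE => /andP[].
  by have [a xa] := cs _ js; exists (at_ j a); rewrite // inE /= js xa eqxx.
apply/diagonal_complementP => t tB xt.
have : t != finset.set0 by apply: contraNneq tB => ->; exact: complex_set0.
case/set0Pn => p0 p0t; move: tB; rewrite inE negb_and => /orP[tK|].
  apply: (xK _ tK); exists (x p0) => _ /imsetP[[j a] pt ->]; exists a.
  exact: xt.
case/forall_inPn => j _; rewrite inE -ltnNge => /card_gt1P[a [b []]].
rewrite !inE => ta tb ab; have xab := xt _ _ ta tb.
by move: ab; rewrite -val_eqE /= neq_ltn => /orP[] /xI; rewrite xab ltxx.
Qed.

(* The difference of two coordinates of the same block does not vanish on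
   [diagonal_complement], hence has constant sign on each component. *)
Lemma increasing_union_of_components :
  union_of_components (diagonal_complement R (blowup K I))
    (diagonal_complement R (blowup K I) `&` increasing R I).
Proof.
(* Each point lies in its own component; conversely, components of increasing points stay in
   [increasing]. *)
exists (diagonal_complement R (blowup K I) `&` increasing R I).
  by move=> x [].
apply/seteqP; split=> [x xDI|y [x [xD xI] [C [Cx CD Cc] Cy]]].
  by exists x => //; apply: connected_component_refl; case: xDI.
split; first exact: CD.
move=> j a b ab.
pose d (z : {ptws _ -> R}) : R := (z (at_ j b) - z (at_ j a))%R.
have dc : continuous d.
  by move=> z; apply: (cvgB (@ptws_eval_continuous R _ (at_ j b) z)
    (@ptws_eval_continuous R _ (at_ j a) z)).
suff : C `&` [set z | (0 < d z)%R] = C.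
  by move=> CE; move: Cy; rewrite -CE => -[_ /=]; rewrite subr_gt0.
(* A nonempty, relatively open and closed part of the connected set [C] is all of [C]. *)
apply: Cc.
- by exists x; split=> //=; rewrite subr_gt0; exact: xI.
- exists [set z | (0 < d z)%R] => //.
  by move/continuousP: dc => /(_ _ (@open_gt R 0%R)).
(* On [C] the weak and strict inequalities agree, because [d] has no zero there. *)
- exists [set z | (0 <= d z)%R].
    by move/continuous_closedP: dc => /(_ _ (@closed_ge R 0%R)).
  apply/seteqP; split=> z [Cz dz]; split=> //=; first exact: ltW.
  move: dz; rewrite /= le_eqVlt => /orP[|//].
  rewrite eq_sym subr_eq0 => /eqP zab.
  have : b != a by rewrite neq_ltn ab orbT.
  by move=> /(diagonal_complement_blowup_neq (CD _ Cz)); rewrite zab eqxx.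
Qed.

End Blowup.

Theorem proposition3p1 (R : realType) (m : nat) (K : complex 'I_m) :
  [/\ homeomorphic (polyconfig R K (fun=> 1%N)) (diagonal_complement R K),
      forall I : 'I_m -> nat, precI I (fun=> 1%N) ->
        homeomorphic (polyconfig R K I)
          (diagonal_complement R (full_subcomplex K (supp I))) &
      forall I : 'I_m -> nat, ~ preceqI I (fun=> 1%N) ->
        union_of_components (diagonal_complement R (blowup K I))
          (diagonal_complement R (blowup K I) `&` increasing R I) /\
        homeomorphic (polyconfig R K I)
          (diagonal_complement R (blowup K I) `&` increasing R I)].
Proof.
split=> [|I [I1 _]|I _].
- apply: (@polyconfig_le1 _ _ _ _ _ id) => // [j _|s]; first by exists j.
  by rewrite imset_id.
- apply: (@polyconfig_le1 _ _ _ _ _ val) => //.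
  + move=> j j0; have jI : j \in supp I by rewrite inE.
    by exists (exist _ j jI).
  + by move=> [j jI] /=; move: jI; rewrite inE.
  + by move=> s; rewrite inE.
- split; first exact: increasing_union_of_components.
  apply: (@polyconfig_homeomorphic _ _ _ _ _ id id) => // x.
  exact: blowup_increasingP.
Qed.
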